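(* Let $\mathbf{C}$ be a small category, $\mathbf{H} : \mathbf{C} \to \mathbf{ncHA}$ a contravariant functor with presheaf of top elements $t_{\mathbf{H}} : \mathbf{T} \to \mathbf{H}$, and $\mathbf{P}$ a presheaf of sets on $\mathbf{C}$. On $\mathbf{Sub}_{\mathbf{H}}(\mathbf{P})$ one can define operations $$(\mathbf{Q},N) \wedge (\mathbf{Q}',N') = (\mathbf{Q} \wedge \mathbf{Q}',N \wedge N'),$$ $$(\mathbf{Q},N) \vee (\mathbf{Q}',N') = (\mathbf{Q} \vee \mathbf{Q}',N \vee N'),$$ $$(\mathbf{Q},N) \rightarrow (\mathbf{Q}',N') = (\mathbf{Q} \rightarrow \mathbf{Q}',N \rightarrow N'),$$ where $\mathbf{Q} \wedge \mathbf{Q}'$, $\mathbf{Q} \vee \mathbf{Q}'$ and $\mathbf{Q} \rightarrow \mathbf{Q}'$ denote the subobjects of $\mathbf{P}$ obtained as the pullbacks of $t_{\mathbf{H}} : \mathbf{T} \to \mathbf{H}$ along $N \wedge N'$, $N \vee N'$ and $N \rightarrow N' : \mathbf{P} \to \mathbf{H}$ respectively. These operations turn the set $\mathbf{Sub}_{\mathbf{H}}(\mathbf{P})$ into a noncommutative complete Heyting algebra with minimal element $(\emptyset, N_0)$ and distinguished top element $(\mathbf{P},N_d)$, where $N_0, N_d : \mathbf{P} \to \mathbf{H}$ are the compositions $$N_0 : \mathbf{P} \to \mathbf{1} \xrightarrow{\,0\,} \mathbf{H}, \qquad N_d : \mathbf{P} \to \mathbf{1} \xrightarrow{\,d\,}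 \mathbf{H},$$ with $\mathbf{P} \to \mathbf{1}$ the unique map to the terminal presheaf, $0$ the global section of bottom elements, and $d$ the global section of $\mathbf{H}$ determined by the distinguished top elements. The top elements of $\mathbf{Sub}_{\mathbf{H}}(\mathbf{P})$ are exactly the pairs $(\mathbf{P},N)$ where $N : \mathbf{P} \to \mathbf{T}$ is a natural transformation.
   Context: A skew lattice is a set $L$ with idempotent, associative binary operations $\wedge,\vee$ satisfying $x \wedge (x \vee y) = x = x \vee (x \wedge y)$ and $(x \wedge y) \vee y = y = (x \vee y) \wedge y$. It is strongly distributive if $(x \vee y) \wedge z = (x \wedge z) \vee (y \wedge z)$ and $x \wedge (y \vee z) = (x \wedge y) \vee (x \wedge z)$. Its natural partial order is: $x \le y$ iff $x \wedge y = x = y \wedge x$. Green's relation: $x \,\mathcal{D}\, y$ iff $x \wedge y \wedge x = x$ and $y \wedge x \wedge y = y$. The quotient $L/\mathcal{D}$ of a strongly distributive skew lattice is a distributive lattice; if it has a maximal element $1$, the corresponding $\mathcal{D}$-class in $L$ is called the set of top elements $T$. A noncommutative Heyting algebra $(H,\wedge,\vee,\rightarrow,0,t)$ is a strongly distributive skew lattice $(H,\wedge,\vee)$ with bottom $0$ and a top $\mathcal{D}$-class $T$, a distinguished element $t \in T$, and a binary operation $\rightarrow$ such that (NH1) $x\rightarrow y = (y\vee(t\wedge x\wedge t)\vee y)\rightarrow y$; (NH2) $x\rightarrow x = x\vee t\vee x$; (NH3) $x\wedge (x\rightarrow y) \wedge x = x\wedge y \wedge x$; (NH4) $y\wedge (x\rightarrow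 y)=y$ and $(x\rightarrow y)\wedge y=y$; (NH5) $x \rightarrow (t\wedge (y\wedge z)\wedge t)= (x\rightarrow (t\wedge y\wedge t)) \wedge (x \rightarrow (t \wedge z\wedge t))$. A subset is commuting if its elements commute pairwise under $\wedge$ and $\vee$. $H$ is complete if all nonempty commuting subsets have suprema and infima for $\le$ and $(\bigvee_i x_i) \wedge y = \bigvee_i (x_i \wedge y)$, $x \wedge (\bigvee_i y_i) = \bigvee_i (x \wedge y_i)$ for all $x,y\in H$ and all commuting subsets $(x_i)_i$, $(y_i)_i$. $\mathbf{ncHA}$ is the category of complete noncommutative Heyting algebras with maps preserving $\leq,\wedge,\vee,\rightarrow,0$ and the distinguished top element $t$. For a contravariant functor $\mathbf{H}:\mathbf{C}\to\mathbf{ncHA}$, $\mathbf{T}$ is the presheaf of sets with $\mathbf{T}(C)$ the set of top elements of $\mathbf{H}(C)$ (the maps $\mathbf{H}(f)$ restrict to top elements), and $t_{\mathbf{H}} : \mathbf{T} \to \mathbf{H}$ is the inclusion. For a presheaf of sets $\mathbf{P}$, $\mathbf{Sub}_{\mathbf{H}}(\mathbf{P})$ is the set of all pairs $(\mathbf{Q},N)$ with $N : \mathbf{P} \to \mathbf{H}$ a natural transformation (of presheaves of sets) and $\mathbf{Q} \subseteq \mathbf{P}$ the subobject that is the pullback of $t_{\mathbf{H}}$ along $N$, i.e. $\mathbf{Q}(C) = \{x \in \mathbf{P}(C) : N(C)(x) \in \mathbf{T}(C)\}$. For natural transformations $N,N' : \mathbf{P}\to\mathbf{H}$, the natural transformations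 $N\wedge N'$, $N \vee N'$, $N \rightarrow N'$ are defined objectwise and pointwise, e.g. $(N\wedge N')(C)(x) = N(C)(x)\wedge N'(C)(x)$.
   Formalization: Morphisms of ncHA are also required to preserve suprema of commuting subsets (otherwise Sub_H(P) need not be complete), and the first component of the minimal element is shown to be empty only when 0 ≠ t in H(C) for every C with P(C) nonempty. *)

(* Defs.v *)
From mathcomp Require Import all_boot.
From mathcomp Require Import boolp classical_sets.

Set Implicit Arguments.
Unset Strict Implicit.
Unset Printing Implicit Defensive.

Local Open Scope classical_set_scope.

Declare Scope skew_scope.
Delimit Scope skew_scope with SK.
Local Open Scope skew_scope.

(** * Skew lattices *)

Record skew_sig := SkewSig {
  skew_car :> Type;
  smeet : skew_car -> skew_car -> skew_car;
  sjoin : skew_car -> skew_car -> skew_car }.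

Notation "x /^\ y" := (smeet x y)
  (at level 40, left associativity) : skew_scope.
Notation "x \v/ y" := (sjoin x y)
  (at level 50, left associativity) : skew_scope.

Record skew_lattice (L : skew_sig) : Prop := {
  smeetxx : forall x : L, x /^\ x = x;
  sjoinxx : forall x : L, x \v/ x = x;
  smeetA : forall x y z : L, x /^\ (y /^\ z) = (x /^\ y) /^\ z;
  sjoinA : forall x y z : L, x \v/ (y \v/ z) = (x \v/ y) \v/ z;
  smeetKU : forall x y : L, x /^\ (x \v/ y) = x;
  sjoinKI : forall x y : L, x \v/ (x /^\ y) = x;
  sjoinIK : forall x y : L, (x /^\ y) \v/ y = y;
  smeetUK : forall x y : L, (x \v/ y) /^\ y = y }.

Record strongly_distributive (L : skew_sig) : Prop := {
  smeetUl : forall x y z : L, (x \v/ y) /^\ z = (x /^\ z) \v/ (y /^\ z);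
  smeetUr : forall x y z : L, x /^\ (y \v/ z) = (x /^\ y) \v/ (x /^\ z) }.

Section SkewOrder.
Variable L : skew_sig.
Implicit Types (x y : L) (S : set L).

Definition sle x y := x /^\ y = x /\ y /^\ x = x.

Definition greenD x y := x /^\ y /^\ x = x /\ y /^\ x /^\ y = y.

(** [x] lies in the maximal element of the quotient of [L] by [greenD]:
    every class [[y]] satisfies [[y] /^\ [x] = [y]]. *)
Definition stops : set L := [set x | forall y, greenD (y /^\ x) y].

Definition commuting S :=
  forall x y, S x -> S y -> x /^\ y = y /^\ x /\ x \v/ y = y \v/ x.

Definition is_sup S s :=
  (forall x, S x -> sle x s) /\
  (forall u, (forall x, S x -> sle x u) -> sle s u).

Definition is_inf S s :=
  (forall x, S x -> sle s x) /\
  (forall u, (forall x, S x -> sle u x) -> sle u s).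

(** The distributive laws also say that the suprema on their right-hand
    sides exist. *)
Record complete_skew : Prop := {
  sup_exists : forall S, S !=set0 -> commuting S -> exists s, is_sup S s;
  inf_exists : forall S, S !=set0 -> commuting S -> exists s, is_inf S s;
  sup_meetl : forall S s y, commuting S -> is_sup S s ->
    is_sup [set x /^\ y | x in S] (s /^\ y);
  sup_meetr : forall S s x, commuting S -> is_sup S s ->
    is_sup [set x /^\ y | y in S] (x /^\ s) }.

End SkewOrder.

(** * Noncommutative Heyting algebras *)

Record ncha_sig := NcHASig {
  ncha_skew :> skew_sig;
  himp : ncha_skew -> ncha_skew -> ncha_skew;
  hbot : ncha_skew;
  htop : ncha_skew }.

Arguments hbot : clear implicits.
Arguments htop : clear implicits.

Notation "x ~~> y" := (himp x y)
  (at level 55, right associativity) : skew_scope.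

Record nc_heyting (H : ncha_sig) : Prop := {
  nh_skew : skew_lattice H;
  nh_sdistr : strongly_distributive H;
  nh_bot : forall x : H, sle (hbot H) x;
  nh_top : stops (htop H);
  nh1 : forall x y : H,
    x ~~> y = (y \v/ (htop H /^\ x /^\ htop H) \v/ y) ~~> y;
  nh2 : forall x : H, x ~~> x = x \v/ htop H \v/ x;
  nh3 : forall x y : H, x /^\ (x ~~> y) /^\ x = x /^\ y /^\ x;
  nh4 : forall x y : H, y /^\ (x ~~> y) = y /\ (x ~~> y) /^\ y = y;
  nh5 : forall x y z : H,
    x ~~> (htop H /^\ (y /^\ z) /^\ htop H) =
    (x ~~> (htop H /^\ y /^\ htop H)) /^\ (x ~~> (htop H /^\ z /^\ htop H)) }.

Definition complete_nc_heyting (H : ncha_sig) : Prop :=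
  nc_heyting H /\ complete_skew H.

Record ncHA := NcHA {
  ncHA_sig :> ncha_sig;
  ncHA_axioms : complete_nc_heyting ncHA_sig }.

(** A morphism of complete algebras preserves the existing joins, that is, also
    the suprema of commuting subsets.  Preservation of the binary operations
    alone would not suffice: natural transformations into a functor [H] with
    such transition maps need not have suprema, since an equalizer of two
    finitary Heyting homomorphisms between complete Boolean algebras (e.g. the
    finite-cofinite subalgebra of the powerset of nat) can be incomplete. *)
Record ncHA_morphism (A B : ncHA) (f : A -> B) : Prop := {
  mor_le : forall x y : A, sle x y -> sle (f x) (f y);
  mor_meet : forall x y : A, f (x /^\ y) = f x /^\ f y;
  mor_join : forall x y : A, f (x \v/ y) = f x \v/ f y;
  mor_sup : forall (S : set A) (s : A), commuting S -> is_sup S s ->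
    is_sup (f @` S) (f s);
  mor_imp : forall x y : A, f (x ~~> y) = f x ~~> f y;
  mor_bot : f (hbot A) = hbot B;
  mor_top : f (htop A) = htop B }.

Record ncHA_hom (A B : ncHA) := NcHAHom {
  hom_fun :> A -> B;
  hom_axioms : ncHA_morphism hom_fun }.

Lemma stopsP (L : skew_sig) (x : L) : skew_lattice L ->
  stops x <-> forall y : L, y /^\ x /^\ y = y.
Proof.
move=> sk; split=> h y.
  by have [_] := h y; rewrite !(smeetA sk) (smeetxx sk).
by split; rewrite !(smeetA sk) ?h (smeetxx sk) // h.
Qed.

Lemma meet_trans (L : skew_sig) (y t u : L) : skew_lattice L ->
  y /^\ t /^\ y = y -> t /^\ u /^\ t = t -> y /^\ u /^\ y = y.
Proof.
move=> sk yty tut.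
have y_ptY : (y /^\ t /^\ u) /^\ (t /^\ y) = y.
  by rewrite -{3}yty -{3}tut !(smeetA sk).
have pY : (y /^\ t /^\ u) /^\ y = y.
  by rewrite -{2}y_ptY (smeetA sk) (smeetxx sk).
have y_ytr : (y /^\ t) /^\ (u /^\ y) = y by rewrite (smeetA sk).
by rewrite -(smeetA sk) -{1}y_ytr -(smeetA sk) (smeetxx sk).
Qed.

Lemma ncHA_hom_stops (A B : ncHA) (f : ncHA_hom A B) (x : A) :
  stops x -> stops (f x).
Proof.
have skA := nh_skew (proj1 (ncHA_axioms A)).
have skB := nh_skew (proj1 (ncHA_axioms B)).
have m := hom_axioms f.
move=> /(stopsP _ skA)/(_ (htop A))/(congr1 f).
rewrite !(mor_meet m) (mor_top m) => tut.
have /(stopsP _ skB) yty := nh_top (proj1 (ncHA_axioms B)).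
by apply/(stopsP _ skB) => y; apply: meet_trans tut.
Qed.

(** * Presheaves on a small category *)

Record category := Category {
  obj :> Type;
  hom : obj -> obj -> Type;
  idm : forall a, hom a a;
  comp : forall a b c, hom b c -> hom a b -> hom a c;
  comp_idl : forall a b (f : hom a b), comp (idm b) f = f;
  comp_idr : forall a b (f : hom a b), comp f (idm a) = f;
  compA : forall a b c d (h : hom c d) (g : hom b c) (f : hom a b),
    comp h (comp g f) = comp (comp h g) f }.

Arguments idm {c} a : rename.

Record presheaf (C : category) := Presheaf {
  psh :> C -> Type;
  res : forall a b, hom a b -> psh b -> psh a;
  res_id : forall a (x : psh a), res (idm a) x = x;
  res_comp : forall a b c (g : hom b c) (f : hom a b) (x : psh c),
    res (comp g f) x = res f (res g x) }.

Record ncHA_presheaf (C : category) := NcHAPresheaf {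
  npsh :> C -> ncHA;
  nres : forall a b, hom a b -> ncHA_hom (npsh b) (npsh a);
  nres_id : forall a (x : npsh a), nres (idm a) x = x;
  nres_comp : forall a b c (g : hom b c) (f : hom a b) (x : npsh c),
    nres (comp g f) x = nres f (nres g x) }.

Definition underlying (C : category) (H : ncHA_presheaf C) : presheaf C :=
  @Presheaf C (fun a => H a) (fun a b f => nres H f) (@nres_id C H)
    (@nres_comp C H).

Record nat_trans (C : category) (P Q : presheaf C) := NatTrans {
  nt :> forall a, P a -> Q a;
  nt_nat : forall a b (f : hom a b) (x : P b),
    nt (res f x) = res f (nt x) }.

Arguments nt {C P Q} n a x : rename.

Lemma nt_comp_subproof (C : category) (P Q R : presheaf C)
    (M : nat_trans Q R) (N : nat_trans P Q) a b (f : hom a b) (x : P b) :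
  M a (N a (res f x)) = res f (M b (N b x)).
Proof. by rewrite !nt_nat. Qed.

Definition nt_comp (C : category) (P Q R : presheaf C)
    (M : nat_trans Q R) (N : nat_trans P Q) : nat_trans P R :=
  NatTrans (nt_comp_subproof M N).

Definition terminal (C : category) : presheaf C :=
  @Presheaf C (fun=> unit) (fun _ _ _ => id) (fun _ _ => erefl)
    (fun _ _ _ _ _ _ => erefl).

Definition to_terminal (C : category) (P : presheaf C) :
    nat_trans P (terminal C) :=
  @NatTrans C P (terminal C) (fun _ _ => tt) (fun _ _ _ _ => erefl).

Record subpresheaf (C : category) (P : presheaf C) := SubPresheaf {
  sp_set :> forall a, set (P a);
  sp_res : forall a b (f : hom a b) (x : P b),
    sp_set x -> sp_set (res f x) }.

Arguments sp_set {C P} s a : rename.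

Lemma subpresheaf_ext (C : category) (P : presheaf C) (Q R : subpresheaf P) :
  (forall a (x : P a), Q a x <-> R a x) -> Q = R.
Proof.
case: Q R => [Q hQ] [R hR] /= QR; have E : Q = R.
  by apply: functional_extensionality_dep => a; apply/seteqP; split=> x /QR.
by case: R / E hR {QR} => hR; congr SubPresheaf; apply: Prop_irrelevance.
Qed.

Definition sp_full (C : category) (P : presheaf C) : subpresheaf P :=
  @SubPresheaf C P (fun=> setT) (fun _ _ _ _ _ => I).

Definition sp_empty (C : category) (P : presheaf C) : subpresheaf P :=
  @SubPresheaf C P (fun=> set0) (fun _ _ _ _ h => h).

Section TopElements.
Variables (C : category) (H : ncHA_presheaf C).

Let tcar (a : C) : Type := {x : H a | stops x}.

Let tres a b (f : hom a b) (x : tcar b) : tcar a :=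
  exist _ (nres H f (sval x)) (ncHA_hom_stops (nres H f) (svalP x)).

Let tres_id a (x : tcar a) : tres (idm a) x = x.
Proof. by case: x => x tx; apply: eq_exist; rewrite /= nres_id. Qed.

Let tres_comp a b c (g : hom b c) (f : hom a b) (x : tcar c) :
  tres (comp g f) x = tres f (tres g x).
Proof. by case: x => x tx; apply: eq_exist; rewrite /= nres_comp. Qed.

Definition top_presheaf : presheaf C := Presheaf tres_id tres_comp.

Definition top_incl : nat_trans top_presheaf (underlying H) :=
  @NatTrans C top_presheaf (underlying H) (fun a x => sval x)
    (fun _ _ _ _ => erefl).

Lemma bot_section_subproof a b (f : hom a b) (x : terminal C b) :
  hbot (H a) = nres H f (hbot (H b)).
Proof. by rewrite (mor_bot (hom_axioms _)). Qed.

Definition bot_section : nat_trans (terminal C) (underlying H) :=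
  @NatTrans C (terminal C) (underlying H) (fun a _ => hbot (H a))
    bot_section_subproof.

Lemma top_section_subproof a b (f : hom a b) (x : terminal C b) :
  htop (H a) = nres H f (htop (H b)).
Proof. by rewrite (mor_top (hom_axioms _)). Qed.

Definition top_section : nat_trans (terminal C) (underlying H) :=
  @NatTrans C (terminal C) (underlying H) (fun a _ => htop (H a))
    top_section_subproof.

End TopElements.

(** * The set [Sub_H(P)] *)

Section SubH.
Variables (C : category) (H : ncHA_presheaf C) (P : presheaf C).
Implicit Types N M : nat_trans P (underlying H).

Definition N0 : nat_trans P (underlying H) :=
  nt_comp (bot_section H) (to_terminal P).

Definition Nd : nat_trans P (underlying H) :=
  nt_comp (top_section H) (to_terminal P).

Let meet_at N M a (x : P a) : H a := N a x /^\ M a x.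
Let join_at N M a (x : P a) : H a := N a x \v/ M a x.
Let imp_at N M a (x : P a) : H a := N a x ~~> M a x.

Lemma nt_meet_subproof N M a b (f : hom a b) (x : P b) :
  meet_at N M (res f x) = nres H f (meet_at N M x).
Proof. by rewrite /meet_at !nt_nat (mor_meet (hom_axioms _)). Qed.

Lemma nt_join_subproof N M a b (f : hom a b) (x : P b) :
  join_at N M (res f x) = nres H f (join_at N M x).
Proof. by rewrite /join_at !nt_nat (mor_join (hom_axioms _)). Qed.

Lemma nt_imp_subproof N M a b (f : hom a b) (x : P b) :
  imp_at N M (res f x) = nres H f (imp_at N M x).
Proof. by rewrite /imp_at !nt_nat (mor_imp (hom_axioms _)). Qed.

Definition nt_meet N M : nat_trans P (underlying H) :=
  @NatTrans C P (underlying H) (meet_at N M) (nt_meet_subproof N M).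

Definition nt_join N M : nat_trans P (underlying H) :=
  @NatTrans C P (underlying H) (join_at N M) (nt_join_subproof N M).

Definition nt_imp N M : nat_trans P (underlying H) :=
  @NatTrans C P (underlying H) (imp_at N M) (nt_imp_subproof N M).

Definition pullback_at N (a : C) : set (P a) :=
  [set x | stops (N a x : H a)].

Lemma pullback_subproof N a b (f : hom a b) (x : P b) :
  pullback_at N x -> pullback_at N (res f x).
Proof. by rewrite /pullback_at /= nt_nat; apply: ncHA_hom_stops. Qed.

Definition pullback N : subpresheaf P := SubPresheaf (@pullback_subproof N).

Record subH := SubH {
  sub_obj : subpresheaf P;
  sub_nt : nat_trans P (underlying H);
  sub_pullback : sub_obj = pullback sub_nt }.

Definition subH_of N : subH := @SubH (pullback N) N erefl.

Lemma top_pair_subproof (M : nat_trans P (top_presheaf H)) :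
  sp_full P = pullback (nt_comp (top_incl H) M).
Proof. by apply: subpresheaf_ext => a x; split=> // _; exact: svalP. Qed.

(** The pair [(P, N)] for [N : P -> T], seen as a map into [H]. *)
Definition top_pair (M : nat_trans P (top_presheaf H)) : subH :=
  SubH (top_pair_subproof M).

Definition sub_meet (A B : subH) : subH :=
  subH_of (nt_meet (sub_nt A) (sub_nt B)).
Definition sub_join (A B : subH) : subH :=
  subH_of (nt_join (sub_nt A) (sub_nt B)).
Definition sub_imp (A B : subH) : subH :=
  subH_of (nt_imp (sub_nt A) (sub_nt B)).

Definition subH_sig : ncha_sig :=
  @NcHASig (SkewSig sub_meet sub_join) sub_imp (subH_of N0) (subH_of Nd).

End SubH.

Arguments N0 {C} H P.
Arguments Nd {C} H P.

(* Main.v *)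
Require Import Defs.
From mathcomp Require Import all_boot.
From mathcomp Require Import boolp classical_sets.

Set Implicit Arguments.
Unset Strict Implicit.
Unset Printing Implicit Defensive.

(** Operations, the order and top elements of [Sub_H(P)] are all computed
    pointwise, so the algebraic axioms are inherited from the [H a].  Suprema of
    commuting subsets are pointwise too, because the transition maps preserve
    them.  Transition maps need not preserve infima, so infima are obtained as
    suprema of lower bounds instead: in a strongly distributive skew lattice any
    two elements with a common upper bound commute, hence the lower bounds of a
    nonempty set form a commuting set. *)

Local Open Scope classical_set_scope.
Local Open Scope skew_scope.

Lemma sle_anti (L : skew_sig) (x y : L) : sle x y -> sle y x -> x = y.
Proof. by move=> [xy _] [_ xy']; rewrite -xy xy'. Qed.

Lemma is_sup_uniq (L : skew_sig) (S : set L) (s s' : L) :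
  is_sup S s -> is_sup S s' -> s = s'.
Proof.
by move=> [us ls] [us' ls']; apply: sle_anti; [apply: ls|apply: ls'].
Qed.

Section BoundedElementsCommute.
Variable L : skew_sig.
Hypotheses (sk : skew_lattice L) (sd : strongly_distributive L).
Implicit Types (x y s : L) (S : set L).

Lemma sle_join x s : sle x s -> x \v/ s = s /\ s \v/ x = s.
Proof.
move=> [xs sx]; split; first by rewrite -{1}xs (sjoinIK sk).
by rewrite -{1}sx (sjoinKI sk).
Qed.

(** Both products equal [y /^\ x /^\ y]. Expanding [y = s /^\ y] with [s = s \v/ x] gives
    [y \v/ (x /^\ y) = y], and symmetrically [(y /^\ x) \v/ y = y]; absorption does the rest. *)
Lemma bounded_meetC x y s : sle x s -> sle y s -> x /^\ y = y /^\ x.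
Proof.
move=> /sle_join [xs sx] [ys sy].
have e1 : y \v/ (x /^\ y) = y.
  by rewrite -{1}sy -(smeetUl sd) sx.
have e2 : (y /^\ x) \v/ y = y.
  by rewrite -{2}ys -(smeetUr sd) xs.
have yxy1 : y /^\ (x /^\ y) = x /^\ y by rewrite -{1}e1 (smeetUK sk).
have yxy2 : (y /^\ x) /^\ y = y /^\ x by rewrite -{2}e2 (smeetKU sk).
by rewrite -yxy1 -yxy2 (smeetA sk).
Qed.

Lemma bounded_joinC x y s : sle x s -> sle y s -> x \v/ y = y \v/ x.
Proof.
have joinM u v : sle u s -> sle v s -> (u \v/ v) /^\ (v \v/ u) = v \v/ u.
  move=> us vs; rewrite (smeetUr sd) (smeetUK sk) (smeetUl sd) (smeetxx sk).
  by rewrite (bounded_meetC vs us) (sjoinKI sk).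
have join_le u v : sle u s -> sle v s -> sle (u \v/ v) s.
  move=> [us su] [vs sv].
  by split; rewrite ?(smeetUl sd) ?(smeetUr sd) ?us ?su ?vs ?sv.
(* By [joinM] each join is the meet of the two joins, in opposite orders; both joins lie below [s],
   so these meets agree. *)
move=> xs ys; rewrite -[LHS](joinM y x ys xs) -[RHS](joinM x y xs ys).
by apply: bounded_meetC (join_le _ _ ys xs) (join_le _ _ xs ys).
Qed.

Lemma bounded_commuting S s : (forall x, S x -> sle x s) -> commuting S.
Proof.
move=> Ss x y /Ss xs /Ss ys.
by split; [apply: bounded_meetC ys|apply: bounded_joinC ys].
Qed.

Lemma inf_of_sups S (b : L) :
  (forall x, sle b x) ->
  (forall R, R !=set0 -> commuting R -> exists s, is_sup R s) ->
  S !=set0 -> exists s, is_inf S s.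
Proof.
move=> ble sup [s0 Ss0].
pose R := [set u | forall x, S x -> sle u x].
have [|r [Rr lr]] := sup R (ex_intro _ b (fun x _ => ble x)).
  by apply: (@bounded_commuting _ s0) => u; apply.
by exists r; split=> [x Sx|u uS]; [apply: lr => u; apply|apply: Rr].
Qed.

End BoundedElementsCommute.

(** The empty family is included, with supremum [hbot A], because the distributive laws of
    [complete_skew] also range over empty sets. *)
Lemma commuting_sup (A : ncHA) (S : set A) :
  commuting S -> exists s, is_sup S s.
Proof.
have [nc cA] := ncHA_axioms A.
have [->|/set0P S0] := eqVneq S set0; last exact: sup_exists cA _ S0.
by exists (hbot A); split=> // u _; apply: nh_bot.
Qed.

Lemma bot_not_stops (A : ncHA) : hbot A <> htop A -> ~ stops (hbot A).
Proof.
have [nc _] := ncHA_axioms A => bt.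
move=> /(stopsP _ (nh_skew nc))/(_ (htop A)) tbt.
by have [b1 b2] := nh_bot nc (htop A); apply: bt; rewrite -tbt b2 b1.
Qed.

Section SubH.
Context {C : category} {H : ncHA_presheaf C} {P : presheaf C}.
Implicit Types (A B : subH_sig H P) (S : set (subH_sig H P)).

Local Notation ev A a x := (sub_nt A a x : ncHA_sig (npsh H a)).
Local Notation evs S a x := [set ev A a x | A in S].

Let ncH (a : C) : nc_heyting (H a) := proj1 (ncHA_axioms (H a)).
Let skH (a : C) : skew_lattice (H a) := nh_skew (ncH a).
Let sdH (a : C) : strongly_distributive (H a) := nh_sdistr (ncH a).
Let cH (a : C) : complete_skew (H a) := proj2 (ncHA_axioms (H a)).

Lemma nat_trans_ext (R Q : presheaf C) (N M : nat_trans R Q) :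
  (forall a x, N a x = M a x) -> N = M.
Proof.
case: N M => [N hN] [M hM] /= NM; have E : N = M.
  apply: functional_extensionality_dep => a.
  by apply: functional_extensionality_dep => x; exact: NM.
by case: M / E hM {NM} => hM; congr NatTrans; apply: Prop_irrelevance.
Qed.

(** The subobject is the pullback along the transformation and so is determined by it; only the
    transformations need comparing. *)
Lemma subH_ext A B : (forall a x, ev A a x = ev B a x) -> A = B.
Proof.
case: A B => [Q N e] [Q' N' e'] /= NN'.
have {}NN' : N = N' by apply: nat_trans_ext.
subst N'; subst Q; subst Q'; congr SubH; exact: Prop_irrelevance.
Qed.

Lemma subH_sleP A B : sle A B <-> forall a x, sle (ev A a x) (ev B a x).
Proof.
split=> [[AB BA] a x|AB].
  by split; [rewrite -{2}AB|rewrite -{2}BA].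
by split; apply: subH_ext => a x; have [] := AB a x.
Qed.

Lemma subH_skew_lattice : skew_lattice (subH_sig H P).
Proof.
split=> *; apply: subH_ext => a x /=; have sk := skH a.
- exact: smeetxx.
- exact: sjoinxx.
- exact: smeetA.
- exact: sjoinA.
- exact: smeetKU.
- exact: sjoinKI.
- exact: sjoinIK.
- exact: smeetUK.
Qed.

Lemma subH_strongly_distributive : strongly_distributive (subH_sig H P).
Proof.
split=> *; apply: subH_ext => a x /=; have sd := sdH a.
- exact: smeetUl.
- exact: smeetUr.
Qed.

Lemma subH_stopsP A : stops A <-> forall a x, stops (ev A a x).
Proof.
split=> [/(stopsP _ subH_skew_lattice) tA a x|tA].
  apply/(stopsP _ (skH a)) => y.
  (* An arbitrary [y] in [H a] need not be a value of a transformation, so [A] is tested only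
     against [Nd], and [y] is then compared with [A] through [htop (H a)]. *)
  have /(stopsP _ (skH a)) top_y := nh_top (ncH a).
  apply: (meet_trans (skH a) (top_y y)).
  by have /(congr1 (fun B => ev B a x)) := tA (htop _).
apply/(stopsP _ subH_skew_lattice) => B; apply: subH_ext => a x /=.
by have /(stopsP _ (skH a)) := tA a x.
Qed.

Lemma subH_nc_heyting : nc_heyting (subH_sig H P).
Proof.
split.
- exact: subH_skew_lattice.
- exact: subH_strongly_distributive.
- by move=> A; apply/subH_sleP => a x; apply: nh_bot.
- by apply/subH_stopsP => a x; apply: nh_top.
- by move=> A B; apply: subH_ext => a x; apply: nh1.
- by move=> A; apply: subH_ext => a x; apply: nh2.
- by move=> A B; apply: subH_ext => a x; apply: nh3.
- by move=> A B; split; apply: subH_ext => a x;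
  have [] := nh4 (ncH a) (ev A a x) (ev B a x).
- by move=> A B D; apply: subH_ext => a x; apply: nh5.
Qed.

Lemma commuting_at S a (x : P a) : commuting S -> commuting (evs S a x).
Proof.
move=> cS _ _ [A SA <-] [B SB <-]; have [m j] := cS _ _ SA SB.
by split; [move/(congr1 (fun D => ev D a x)): m|
           move/(congr1 (fun D => ev D a x)): j].
Qed.

Lemma is_sup_pointwise S A :
  (forall a x, is_sup (evs S a x) (ev A a x)) -> is_sup S A.
Proof.
move=> supA; split=> [B SB|U US]; apply/subH_sleP => a x.
  by apply: (supA a x).1; exists B.
by apply: (supA a x).2 => _ [B /US/subH_sleP BU <-]; apply: BU.
Qed.

Lemma pointwise_sup S : commuting S ->
  exists A, forall a x, is_sup (evs S a x) (ev A a x).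
Proof.
move=> cS; have cSx a (x : P a) := @commuting_at S a x cS.
pose w a x := cid (commuting_sup (cSx a x)).
(* The chosen suprema are natural: [nres H f] preserves them, and by naturality of the members of
   [S] it carries the values at [x] onto those at [res f x]. *)
have nat_w a b (f : hom a b) (x : P b) :
    sval (w a (res f x)) = nres H f (sval (w b x)).
  have := mor_sup (hom_axioms (nres H f)) (cSx b x) (svalP (w b x)).
  rewrite image_comp; apply: is_sup_uniq.
  have -> : [set (nres H f \o (fun A => ev A b x)) A | A in S]
            = evs S a (res f x).
    by apply: eq_imagel => A _; rewrite /= nt_nat.
  exact: svalP.
exists (subH_of (@NatTrans C P (underlying H) _ nat_w)) => a x.
exact: svalP (w a x).
Qed.

(** By uniqueness, any supremum of [S] is the pointwise one. This lets the distributive laws be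
    checked in each [H a]. *)
Lemma is_sup_at S A a (x : P a) :
  commuting S -> is_sup S A -> is_sup (evs S a x) (ev A a x).
Proof.
move=> cS supA; have [B supB] := pointwise_sup cS.
by rewrite (is_sup_uniq supA (is_sup_pointwise supB)).
Qed.

Lemma subH_complete : complete_skew (subH_sig H P).
Proof.
have sup S : S !=set0 -> commuting S -> exists A, is_sup S A.
  move=> _ /pointwise_sup[A supA]; exists A; exact: is_sup_pointwise.
split=> // [S S0 cS|S A B cS supA|S A B cS supA].
- exact: (inf_of_sups subH_skew_lattice subH_strongly_distributive
    (nh_bot subH_nc_heyting) sup S0).
- apply: is_sup_pointwise => a x; rewrite image_comp.
  have := sup_meetl (cH a) (ev B a x) (commuting_at cS) (is_sup_at x cS supA).
  by rewrite image_comp.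
- apply: is_sup_pointwise => a x; rewrite image_comp.
  have := sup_meetr (cH a) (ev B a x) (commuting_at cS) (is_sup_at x cS supA).
  by rewrite image_comp.
Qed.

Lemma top_pairP A :
  stops A <-> exists N : nat_trans P (top_presheaf H), A = top_pair N.
Proof.
split=> [/subH_stopsP tA|[N ->]]; last first.
  by apply/subH_stopsP => a x; exact: svalP.
(* Pairing each value of [A] with its proof of being top factors the transformation through
   [top_presheaf]. *)
have natN a b (f : hom a b) (x : P b) :
    exist _ _ (tA a (res f x)) =
    res (p := top_presheaf H) f (exist _ _ (tA b x)).
  by apply: eq_exist; rewrite /= nt_nat.
exists (@NatTrans C P (top_presheaf H) _ natN).
exact: subH_ext.
Qed.

End SubH.

Theorem lemma3 (C : category) (H : ncHA_presheaf C) (P : presheaf C) :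
  complete_nc_heyting (subH_sig H P) /\
  (sub_nt (hbot (subH_sig H P)) = N0 H P /\
   ((forall a : C, P a -> hbot (H a) <> htop (H a)) ->
    sub_obj (hbot (subH_sig H P)) = sp_empty P)) /\
  (sub_nt (htop (subH_sig H P)) = Nd H P /\
   sub_obj (htop (subH_sig H P)) = sp_full P) /\
  (forall A : subH_sig H P,
    stops A <-> exists N : nat_trans P (top_presheaf H), A = top_pair N).
Proof.
split; first by split; [exact: subH_nc_heyting|exact: subH_complete].
split; first split=> // bt.
  (* A point of the pullback along [N0] would make [hbot (H a)] a top element, forcing it to equal
     [htop (H a)]. *)
  by apply: subpresheaf_ext => a x; split=> // /(bot_not_stops (bt a x)).
split; last exact: top_pairP.
split=> //; apply: subpresheaf_ext => a x; split=> // _.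
exact: nh_top (ncHA_axioms (H a)).1.
Qed.
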